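(* Let $q$ be a prime power with $q-1=ml^2$ for integers $l,m\ge 2$. Let $\theta$ be a primitive element of $\mathbb{F}_q$, put $\beta=\theta^l$, $C=\langle\beta^m\rangle=\langle\theta^{ml}\rangle\le\mathbb{F}_q^*$, $H=\langle\beta\rangle\le\mathbb{F}_q^*$, and $A_j=\beta^jC$ for $0\le j\le m-1$. Then for any non-empty subset $S\subseteq\{1,\dots,m-1\}$, the family $\{A_0,\dots,A_{m-1}\}$ is a $(q,m,l;|S|)$-$S$-CEDF in $(\mathbb{F}_q,+)$ if and only if every coset of $H$ in $\mathbb{F}_q^*$ contains exactly $|S|$ elements of the set $$\bigcup_{c\in S}\{x-1:\ x\in A_c\}=\{\beta^{c+km}-1:\ 0\le k\le l-1,\ c\in S\}.$$
   Context: Let $(G,+)$ be a finite abelian group of order $n$ (written additively), let $l,m\ge 2$, and let $S$ be a non-empty subset of $\{1,\dots,m-1\}$. For non-empty subsets $A,B\subseteq G$, $\Delta(A,B)$ denotes the multiset $\{\{a-b: a\in A, b\in B\}\}$. A family $\{A_0,\dots,A_{m-1}\}$ of $m$ pairwise disjoint subsets of $G$ is an $(n,m,l;\lambda)$-$S$-circular external difference family (CEDF) in $G$ if $|A_i|=l$ for all $i$ and each nonzero $g\in G$ occurs exactly $\lambda$ times in the multiset union $\bigcup_{c\in S}\bigcup_{i=0}^{m-1}\Delta(A_{i+c},A_i)$, where subscripts are taken modulo $m$. *)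

(* Defs.v *)
From mathcomp Require Import all_boot all_order all_fingroup all_algebra.
From mathcomp Require Import all_solvable all_field.

Set Implicit Arguments.
Unset Strict Implicit.
Unset Printing Implicit Defensive.

Import GRing.Theory.
Local Open Scope ring_scope.

Lemma shift_ord_subproof (m : nat) (i : 'I_m) (c : nat) : ((i + c) %% m < m)%N.
Proof. by rewrite ltn_pmod // (leq_ltn_trans (leq0n i) (ltn_ord i)). Qed.

Definition shift_ord (m : nat) (i : 'I_m) (c : nat) : 'I_m :=
  Ordinal (shift_ord_subproof i c).

(* Multisets are represented by sequences: multiplicity is [count_mem], *)
(* and multiset union is concatenation.                                 *)
Definition Delta (G : finZmodType) (A B : {set G}) : seq G :=
  [seq a - b | a <- enum A, b <- enum B].

Definition circular_differences (G : finZmodType) (m : nat) (S : {set 'I_m})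
    (A : 'I_m -> {set G}) : seq G :=
  \big[cat/[::]]_(c in S) \big[cat/[::]]_(i < m) Delta (A (shift_ord i c)) (A i).

(* (n, m, l; lambda)-S-circular external difference family in G; S ranges *)
(* over the non-empty sets of nonzero residues, i.e. subsets of           *)
(* {1, ..., m - 1}.                                                       *)
Record is_CEDF (G : finZmodType) (n m l lambda : nat) (S : {set 'I_m})
    (A : 'I_m -> {set G}) : Prop := IsCEDF {
  CEDF_order : #|G| = n;
  CEDF_m_ge2 : (2 <= m)%N;
  CEDF_l_ge2 : (2 <= l)%N;
  CEDF_S_neq0 : S != set0;
  CEDF_S_pos : S \subset [set c : 'I_m | (0 < c)%N];
  CEDF_disjoint : forall i j : 'I_m, i != j -> [disjoint A i & A j];
  CEDF_card : forall i : 'I_m, #|A i| = l;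
  CEDF_count : forall g : G, g != 0 ->
    count_mem g (circular_differences S A) = lambda
}.

Arguments is_CEDF {G} n m l lambda S A.

Definition uimage (F : finFieldType) (X : {set {unit F}}) : {set F} :=
  [set FinRing.uval u | u in X].

(* Main.v *)
(** Every [b] in [H] lies in exactly one [A i], and for such [b] the map
    [x |-> b x] carries [A c] onto [A (i + c)].  So the representations of [g]
    as a circular difference are the pairs [b] in [H], [x] in [A c] ([c] in
    [S]) with [b (x - 1) = g], that is, the elements [x - 1] of [T] in the
    coset [g H]. *)
Require Import Defs.
From mathcomp Require Import all_boot all_order all_fingroup all_algebra.
From mathcomp Require Import all_solvable all_field.

Import GRing.Theory.
Local Open Scope ring_scope.

Section CyclicCosets.

Local Open Scope group_scope.

Variables (gT : finGroupType) (b : gT) (m l : nat).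
Hypotheses (m_gt0 : (0 < m)%N) (ord_b : #[b] = (m * l)%N).

(** Exponents of [b] are determined modulo [m * l], hence modulo [m], and a factor from [<[b ^+ m]>]
    shifts them by a multiple of [m]. Membership in these cosets thus becomes arithmetic of
    residues. *)
Lemma mem_expg_lcoset (a j : nat) :
  (b ^+ a \in b ^+ j *: <[b ^+ m]>) = (a == j %[mod m]).
Proof.
apply/idP/idP => [/lcosetP[_ /cycleP[k ->]]|/eqP aj].
  rewrite -expgM -expgD => /eqP; rewrite eq_expg_mod_order ord_b.
  move=> /eqP /(congr1 (modn^~ m)); rewrite !modn_dvdm ?dvdn_mulr // => ->.
  by rewrite addnC mulnC modnMDl.
have bmC (k : nat) : b ^+ (k * m) \in <[b ^+ m]>.
  by rewrite mulnC expgM mem_cycle.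
rewrite mem_lcoset (divn_eq a m) (divn_eq j m) aj.
by rewrite !(addnC _ (j %% m)%N) !expgD invMg -mulgA mulKg groupM ?groupV.
Qed.

Lemma lcoset_expg_subset (j : nat) : b ^+ j *: <[b ^+ m]> \subset <[b]>.
Proof.
apply/subsetP => _ /lcosetP[y /cycleP[k ->] ->].
by rewrite -expgM -expgD mem_cycle.
Qed.

Lemma card_cycle_expg : #|<[b ^+ m]>| = l.
Proof.
have := order_gt0 b; rewrite ord_b muln_gt0 => /andP[_ l_gt0].
by rewrite -orderE orderXdiv ord_b ?dvdn_mulr // mulKn.
Qed.

Lemma disjoint_expg_lcosets (i j : 'I_m) :
  i != j -> [disjoint b ^+ i *: <[b ^+ m]> & b ^+ j *: <[b ^+ m]>].
Proof.
move=> ij; apply/pred0P => v /=; apply: contraNF ij => /andP[vi].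
have /cycleP[a va] := subsetP (lcoset_expg_subset i) v vi.
move: vi; rewrite va !mem_expg_lcoset => /eqP -> /eqP.
by rewrite !modn_small // => /val_inj ->.
Qed.

(** The cosets partition [<[b]>]: once the sums are exchanged, [b ^+ a] is met only at the index
    [a %% m]. *)
Lemma sum_expg_lcosets (f : gT -> nat) :
  (\sum_(i < m) \sum_(v in b ^+ i *: <[b ^+ m]>) f v = \sum_(v in <[b]>) f v)%N.
Proof.
rewrite (exchange_big_dep (mem <[b]>)) /= => [|i v _]; last first.
  exact/subsetP/lcoset_expg_subset.
apply: eq_bigr => _ /cycleP[a ->].
rewrite (big_pred1 (Ordinal (ltn_pmod a m_gt0))) // => i /=.
by rewrite mem_expg_lcoset -val_eqE /= (modn_small (ltn_ord i)) eq_sym.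
Qed.

(** For [w] in [<[b]>] the exponents add modulo [m]. For [w] outside, [v * w] is outside as well, so
    both memberships fail; this case matters because [w] will be an arbitrary unit of the field. *)
Lemma mul_mem_expg_lcoset (i : 'I_m) (c : nat) (v w : gT) :
    v \in b ^+ i *: <[b ^+ m]> ->
  (v * w \in b ^+ shift_ord i c *: <[b ^+ m]>) = (w \in b ^+ c *: <[b ^+ m]>).
Proof.
move=> vi; have /cycleP[a va] := subsetP (lcoset_expg_subset i) v vi.
have [/cycleP[d ->]|wH] := boolP (w \in <[b]>).
  move: vi; rewrite va -expgD !mem_expg_lcoset /= modn_mod => /eqP ai.
  by rewrite -modnDml ai modnDml eqn_modDl.
rewrite [RHS](contraNF (subsetP (lcoset_expg_subset _) _) wH).
apply: contraNF wH => /(subsetP (lcoset_expg_subset _)).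
by rewrite va groupMl ?mem_cycle.
Qed.

End CyclicCosets.

Lemma count_big_cat (T : Type) (I : finType) (P : pred I) (p : pred T)
    (f : I -> seq T) :
  count p (\big[cat/[::]]_(i | P i) f i) = (\sum_(i | P i) count p (f i))%N.
Proof. by apply: (big_morph (count p)) => // s t; apply: count_cat. Qed.

(** For fixed [b] the equation [a - b = g] has the single solution [a = g + b]. *)
Lemma count_Delta (G : finZmodType) (A B : {set G}) (g : G) :
  count_mem g (Delta A B) = (\sum_(b in B) ((g + b)%R \in A))%N.
Proof.
rewrite /Delta count_flatten -map_comp sumnE big_map big_enum /=.
under eq_bigr => a _.
  rewrite /= count_map -sum1_count big_enum_cond /= big_mkcondr /=; over.
rewrite exchange_big; apply: eq_bigr => b _.
transitivity (\sum_(a in A) (a == (g + b)%R : nat))%N.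
  by apply: eq_bigr => a _; rewrite subr_eq; case: eqP.
have [gbA|gbA] := boolP (g + b \in A).
  rewrite (bigD1 (g + b)) //= eqxx big1 // => a /andP[_ /negPf ->] //.
by rewrite big1 // => a aA; case: eqP gbA => // <-; rewrite aA.
Qed.

Section UnitImages.

Variable F : finFieldType.

Lemma mem_uimage (X : {set {unit F}}) (u : {unit F}) :
  (FinRing.uval u \in uimage X) = (u \in X).
Proof. exact/mem_imset/val_inj. Qed.

Lemma uimage_neq0 (X : {set {unit F}}) (x : F) : x \in uimage X -> x != 0.
Proof.
by case/imsetP=> u _ ->; rewrite -unitfE; apply: (valP u).
Qed.

Lemma uval_surj (x : F) : x != 0 -> exists u : {unit F}, FinRing.uval u = x.
Proof. by rewrite -unitfE => xU; exists (FinRing.Unit xU). Qed.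

Lemma disjoint_uimage (X Y : {set {unit F}}) :
  [disjoint X & Y] -> [disjoint uimage X & uimage Y].
Proof.
move=> dXY; apply/pred0P => x /=; apply/negP => /andP[/imsetP[u uX ->]].
by rewrite mem_uimage (disjointFr dXY uX).
Qed.

Lemma card_uimage (X : {set {unit F}}) : #|uimage X| = #|X|.
Proof. exact/card_imset/val_inj. Qed.

Lemma sum_uimage (X : {set {unit F}}) (f : F -> nat) :
  (\sum_(x in uimage X) f x = \sum_(u in X) f (FinRing.uval u))%N.
Proof. by rewrite big_imset //= => u v _ _; apply: val_inj. Qed.

End UnitImages.

Section CircularDifferences.

Variables (F : finFieldType) (b : {unit F}) (m l : nat) (S : {set 'I_m}).
Hypotheses (m_gt0 : (0 < m)%N) (ord_b : #[b]%g = (m * l)%N).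

Let A (j : 'I_m) : {set F} := uimage (b ^+ j *: <[b ^+ m]>)%g.
Let T : {set F} := \bigcup_(c in S) [set x - 1 | x : F in A c].

Lemma disjoint_cosets (i j : 'I_m) : i != j -> [disjoint A i & A j].
Proof.
by move=> ij; apply: disjoint_uimage; apply: disjoint_expg_lcosets ord_b _ _ ij.
Qed.

(** By disjointness of the [A c] at most one term is nonzero, so taking the union over [S] loses no
    multiplicity. This turns the count in a multiset into the cardinality of a set. *)
Lemma sub1_bigcup_cosets (x : F) :
  (x \in T) = (\sum_(c in S) ((x + 1)%R \in A c))%N :> nat.
Proof.
have memT (c : 'I_m) : (x \in [set y - 1 | y in A c]) = (x + 1 \in A c).
  apply/imsetP/idP => [[y yA ->]|xA]; first by rewrite subrK.
  by exists (x + 1); rewrite ?addrK.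
have [/bigcupP[c cS]|xT] := boolP (x \in T).
  rewrite memT => xc; rewrite (bigD1 c) //= xc big1 // => d /andP[_ dc].
  by rewrite (disjointFl (disjoint_cosets _ _ dc) xc).
rewrite big1 // => c cS; apply/eqP; rewrite eqb0 -memT.
by apply: contra xT => xc; apply/bigcupP; exists c.
Qed.

Lemma count_circular_differences (u : {unit F}) :
  count_mem (FinRing.uval u) (circular_differences S A)
    = #|uimage (u *: <[b]>)%g :&: T|.
Proof.
rewrite /circular_differences count_big_cat.
(* Factoring [u + v = v * (u * v^-1 + 1)] replaces membership in [A (shift_ord i c)] by membership
   of the second factor in [A c]. The index [i] disappears from the condition, and the sums over the
   cosets merge into one over [<[b]>]. *)
transitivity
  (\sum_(c in S) \sum_(v in <[b]>%g)
     ((FinRing.uval (u * v^-1)%g + 1)%R \in A c))%N.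
  apply: eq_bigr => c _; rewrite count_big_cat -(sum_expg_lcosets _ _ m l) //.
  apply: eq_bigr => i _; rewrite count_Delta sum_uimage.
  apply: eq_bigr => v vi; congr nat_of_bool.
  have -> : FinRing.uval u + FinRing.uval v
      = FinRing.uval v * (FinRing.uval (u * v^-1)%g + 1).
    rewrite mulrDr mulr1 /= mulrC mulrVK //; exact: (valP v).
  (* The second factor vanishes when [v] is [- u]; both memberships then fail, since the sets [A j]
     contain only units. *)
  have [->|/uval_surj[w <-]] := eqVneq (FinRing.uval (u * v^-1)%g + 1) 0.
    rewrite mulr0; apply/idP/idP => /uimage_neq0; by rewrite eqxx.
  by rewrite -FinRing.val_unitM !mem_uimage (mul_mem_expg_lcoset _ _ _ l).
rewrite exchange_big -sum1_card /=.
under [RHS]eq_bigl do rewrite in_setI.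
rewrite big_mkcondr sum_uimage /=.
(* The map [v |-> u * v^-1] carries [<[b]>] bijectively onto the coset of [u]. *)
rewrite [RHS](reindex (fun v => u * v^-1)%g) /=; last first.
  by exists (fun v => v^-1 * u)%g => v _; rewrite ?invMg ?invgK ?mulgKV ?mulKVg.
apply: eq_big => [v|v _]; first by rewrite mem_lcoset mulKg groupV.
by rewrite -sub1_bigcup_cosets; case: (_ \in T).
Qed.

(** Exponents [k < l] suffice because [b ^+ m] has order [l]. *)
Lemma bigcup_cosets_sub1E :
  T = [set FinRing.uval (b ^+ (c + k * m)%N)%g - 1
        | k : 'I_l in [set: 'I_l], c : 'I_m in S].
Proof.
have ord_bm : #[b ^+ m]%g = l by rewrite orderE (card_cycle_expg _ _ _ l).
apply/setP => x; apply/bigcupP/imset2P => [[c cS]|[k c _ cS ->]].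
  case/imsetP=> _ /imsetP[_ /lcosetP[_ /cyclePmin[k kl ->] ->] ->] ->.
  rewrite ord_bm in kl.
  by exists (Ordinal kl) c; rewrite ?inE // -expgM -expgD mulnC.
exists c => //; apply: imset_f; rewrite mem_uimage.
by rewrite (mem_expg_lcoset _ _ _ l) // addnC modnMDl.
Qed.

End CircularDifferences.

Theorem theorem3 (F : finFieldType) (q l m : nat) (theta : {unit F})
    (hq : #|F| = q) (hl : (2 <= l)%N) (hm : (2 <= m)%N)
    (hqlm : (q - 1 = m * l ^ 2)%N)
    (htheta : generator [set: {unit F}] theta)
    (S : {set 'I_m}) (hS0 : S != set0)
    (hS : S \subset [set c : 'I_m | (0 < c)%N]) :
  let beta : {unit F} := (theta ^+ l)%g in
  let C : {set {unit F}} := (<[beta ^+ m]>)%g in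
  let H : {set {unit F}} := (<[beta]>)%g in
  let A : 'I_m -> {set F} := fun j => uimage (beta ^+ j *: C)%g in
  let T : {set F} := \bigcup_(c in S) [set x - 1 | x : F in A c] in
  T = [set FinRing.uval (beta ^+ (c + k * m)%N)%g - 1
        | k : 'I_l in [set: 'I_l], c : 'I_m in S] /\
  (is_CEDF q m l #|S| S A <->
   forall D : {set {unit F}}, D \in lcosets H [set: {unit F}] ->
     #|uimage D :&: T| = #|S|).
Proof.
have m_gt0 : (0 < m)%N by apply: ltnW.
have l_gt0 : (0 < l)%N by apply: ltnW.
move=> beta C H A T.
(* A primitive element has order [q - 1], which is [m * l ^ 2]; its power [beta] then has order
   [m * l], as the coset lemmas require. *)
have ord_theta : #[theta]%g = (m * l * l)%N.
  rewrite orderE -(eqP htheta) card_finField_unit hq -subn1 hqlm.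
  by rewrite -mulnA mulnn.
have ord_beta : #[beta]%g = (m * l)%N.
  by rewrite orderXdiv ord_theta ?dvdn_mull // mulnK.
split; first exact: bigcup_cosets_sub1E.
split=> [[_ _ _ _ _ _ _ cnt] D /lcosetsP[u _ ->]|cosetT].
  rewrite -(count_circular_differences _ _ _ l) // cnt //.
  by rewrite -unitfE; apply: (valP u).
(* Disjointness and size come from the coset structure; the count at a unit [u] is the assumption
   [cosetT] for the coset of [H] through [u]. *)
split=> // [i j||g /uval_surj[u <-]].
- exact: (disjoint_cosets _ _ _ l).
- by move=> i; rewrite card_uimage card_lcoset (card_cycle_expg _ _ _ l).
- rewrite (count_circular_differences _ _ _ l) //; apply: cosetT.
  by apply/lcosetsP; exists u; rewrite ?inE.
Qed.
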